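(* Let $V$ be a (real) vector space endowed with a rotund norm. Then every non-empty finite subset $S\subset V$ admits a restricted minimal enclosing ball, of radius $$r_S:=\inf_{v\in\mathrm{Conv}(S)}\ \max_{s\in S}\|s-v\|,$$ and this ball is unique. Moreover, the function $$\mathrm{Exp}^\ast_{\mathrm M}(V)\longrightarrow V\times\mathbf R_+,\qquad S\mapsto(c_S,r_S),$$ where $c_S$ denotes the center of the restricted minimal enclosing ball of $S$, is continuous.
   Context: A norm is rotund if $\|x\|=\|y\|=\|\tfrac{x+y}{2}\|$ holds only when $x=y$ (strictly convex closed unit ball). $\mathrm{Conv}(S)$ is the convex hull of $S$. A restricted minimal enclosing ball of a non-empty finite subset $S\subset V$ is a closed ball $B\subset V$ containing $S$, with center in $\mathrm{Conv}(S)$, and of smallest radius among all closed balls containing $S$ with center in $\mathrm{Conv}(S)$ (a single point counts as a ball of radius $0$). $\mathrm{Exp}^\ast_{\mathrm M}(V)$ is the set of non-empty finite subsets of $V$ with the Hausdorff metric $D(S,T)=\max\big(\max_{s\in S}\min_{t\in T}\|s-t\|,\ \max_{t\in T}\min_{s\in S}\|s-t\|\big)$. *)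

(* Defs.v *)
From HB Require Import structures.
From mathcomp Require Import all_boot all_order all_algebra finmap.
From mathcomp Require Import all_classical all_reals all_analysis.

Set Implicit Arguments.
Unset Strict Implicit.
Unset Printing Implicit Defensive.

Import Order.TTheory GRing.Theory Num.Theory.
Import numFieldNormedType.Exports.

Local Open Scope classical_set_scope.
Local Open Scope ring_scope.

Definition rotund (R : realType) (V : normedModType R) : Prop :=
  forall x y : V, `|x| = `|y| -> `|y| = `|2^-1 *: (x + y)| -> x = y.

Definition conv_hull (R : realType) (V : normedModType R) (A : set V) : set V :=
  smallest (@convex_set R V) A.

Record Exp_M (R : realType) (V : normedModType R) := MkExp {
  points :> {fset V};
  points_neq0 : points != fset0
}.

HB.instance Definition _ (R : realType) (V : normedModType R) :=
  [isSub for @points R V].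
HB.instance Definition _ (R : realType) (V : normedModType R) :=
  [Choice of Exp_M V by <:].

Section extrema.
Context {R : realType} {V : normedModType R}.
Implicit Types (S : Exp_M V) (f : V -> R).

Definition some_point S : V := xchoose (fset0Pn _ (points_neq0 S)).

Lemma some_point_in S : some_point S \in points S.
Proof. exact: xchooseP. Qed.

(* Seeding the iterated extrema with a value of [f] on [S], instead of with a
   constant, makes them the true maximum and minimum of [f] over [S]. *)
Definition max_over S f : R := \big[Order.max/f (some_point S)]_(s <- points S) f s.
Definition min_over S f : R := \big[Order.min/f (some_point S)]_(s <- points S) f s.

Lemma max_over_ge S f s : s \in points S -> f s <= max_over S f.
Proof. by move=> sS; exact: le_bigmax_seq. Qed.

Lemma min_over_le S f s : s \in points S -> min_over S f <= f s.
Proof. by move=> sS; exact: ge_bigmin_seq. Qed.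

Lemma max_over_attained S f : exists2 s, s \in points S & max_over S f = f s.
Proof.
rewrite /max_over; have := some_point_in S; move: (some_point S) => p pS.
rewrite big_seq; elim/big_ind: _ => [|x y [s sS ->] [t tS ->]|s sS].
- by exists p.
- by case: (leP (f s) (f t)) => _; [exists t|exists s].
- by exists s.
Qed.

Lemma min_over_attained S f : exists2 s, s \in points S & min_over S f = f s.
Proof.
rewrite /min_over; have := some_point_in S; move: (some_point S) => p pS.
rewrite big_seq; elim/big_ind: _ => [|x y [s sS ->] [t tS ->]|s sS].
- by exists p.
- by case: (leP (f s) (f t)) => _; [exists s|exists t].
- by exists s.
Qed.

End extrema.

Section hausdorff_distance.
Context {R : realType} {V : normedModType R}.
Implicit Types S T U : Exp_M V.

Definition hausdorff_dist S T : R :=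
  Order.max (max_over S (fun s => min_over T (fun t => `|s - t|)))
            (max_over T (fun t => min_over S (fun s => `|s - t|))).

Lemma hausdorff_dist_leP S T (e : R) :
  hausdorff_dist S T <= e <->
  (forall s, s \in points S -> exists2 t, t \in points T & `|s - t| <= e) /\
  (forall t, t \in points T -> exists2 s, s \in points S & `|s - t| <= e).
Proof.
rewrite /hausdorff_dist ge_max; split=> [/andP[ST TS]|[ST TS]].
- split=> [s sS|t tT].
  + have [t tT te] := min_over_attained T (fun t => `|s - t|).
    exists t => //; rewrite -te; apply: le_trans ST.
    exact: (max_over_ge (fun s => min_over T (fun t => `|s - t|))).
  + have [s sS se] := min_over_attained S (fun s => `|s - t|).
    exists s => //; rewrite -se; apply: le_trans TS.
    exact: (max_over_ge (fun t => min_over S (fun s => `|s - t|))).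
- apply/andP; split.
  + have [s sS ->] := max_over_attained S
      (fun s => min_over T (fun t => `|s - t|)).
    have [t tT] := ST s sS; apply: le_trans.
    exact: (min_over_le (fun t => `|s - t|)).
  + have [t tT ->] := max_over_attained T
      (fun t => min_over S (fun s => `|s - t|)).
    have [s sS] := TS t tT; apply: le_trans.
    exact: (min_over_le (fun s => `|s - t|)).
Qed.

Lemma hausdorff_dist_sym S T : hausdorff_dist S T = hausdorff_dist T S.
Proof.
suff le S' T' : hausdorff_dist S' T' <= hausdorff_dist T' S'.
  by apply/eqP; rewrite eq_le !le.
have /hausdorff_dist_leP[TS ST] := lexx (hausdorff_dist T' S').
apply/hausdorff_dist_leP; split=> [s /ST|t /TS] [x xin xe];
  by exists x; rewrite // distrC.
Qed.

Lemma hausdorff_dist_triangle T S U :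
  hausdorff_dist S U <= hausdorff_dist S T + hausdorff_dist T U.
Proof.
have /hausdorff_dist_leP[ST TS] := lexx (hausdorff_dist S T).
have /hausdorff_dist_leP[TU UT] := lexx (hausdorff_dist T U).
apply/hausdorff_dist_leP; split=> [s /ST[t tT st]|u /UT[t tT tu]].
- have [u uU tu] := TU t tT; exists u => //.
  by rewrite (le_trans (ler_distD t s u)) ?lerD.
- have [s sS st] := TS t tT; exists s => //.
  by rewrite (le_trans (ler_distD t s u)) ?lerD.
Qed.

Lemma hausdorff_distxx S : hausdorff_dist S S = 0.
Proof.
have le0 : hausdorff_dist S S <= 0.
  by apply/hausdorff_dist_leP; split=> s sS; exists s; rewrite ?subrr ?normr0.
apply/eqP; rewrite eq_le le0/=.
have /hausdorff_dist_leP[SS _] := lexx (hausdorff_dist S S).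
have [t _] := SS _ (some_point_in S); exact: le_trans.
Qed.

Lemma hausdorff_dist_positivity S T : hausdorff_dist S T = 0 -> S = T.
Proof.
move=> ST0; have := lexx (hausdorff_dist S T).
rewrite {2}ST0 => /hausdorff_dist_leP[ST TS].
apply/val_inj/fsetP => x; apply/idP/idP => [/ST|/TS] [y yin];
  by rewrite normr_le0 subr_eq0 => /eqP xy; rewrite ?xy // -xy.
Qed.

HB.instance Definition _ := @isMetric.Build R (Exp_M V) hausdorff_dist
  hausdorff_distxx hausdorff_dist_positivity hausdorff_dist_sym
  hausdorff_dist_triangle.

End hausdorff_distance.

Section minimal_enclosing_ball.
Context {R : realType} {V : normedModType R}.
Implicit Types (S : Exp_M V) (c : V) (r : R).

(* The ball with center [c] and radius [r]. The library's [closed_ball], being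
   the closure of an open ball, is empty for [r = 0]; [closed_ball_] is not. *)
Definition encloses S c r : Prop :=
  [/\ 0 <= r, conv_hull [set` points S] c &
      [set` points S] `<=` closed_ball_ Num.norm c r].

Definition restricted_minimal_enclosing S c r : Prop :=
  encloses S c r /\ forall c' r', encloses S c' r' -> r <= r'.

Definition rme_radius S : R :=
  inf [set max_over S (fun s => `|s - v|) | v in conv_hull [set` points S]].

Definition rme_center S : V :=
  xget 0 [set c | exists r, restricted_minimal_enclosing S c r].

Lemma rme_radius_ge0 S : 0 <= rme_radius S.
Proof.
apply: lb_le_inf => [|_ [v _ <-]].
  exists (max_over S (fun s => `|s - some_point S|)), (some_point S) => //.
  by move=> A [_]; apply; exact: some_point_in.
have [s _ ->] := max_over_attained S (fun s => `|s - v|).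
exact: normr_ge0.
Qed.

(* [R_+], with the topology induced by [R]. *)
Definition nonneg_reals := set_type [set r : R | 0 <= r].

Definition rme_radius_nonneg S : nonneg_reals :=
  exist _ (rme_radius S) (mem_set (rme_radius_ge0 S)).

End minimal_enclosing_ball.
Arguments nonneg_reals : clear implicits.

(* Main.v *)
(* The convex hull of a finite set [S] is compact, since adding a point [x] to a
   set turns its convex hull [K] into the image of [0, 1] x K under
   (t, y) |-> (1 - t) x + t y. The function v |-> max_(s in S) |s - v| is
   1-Lipschitz, hence attains its minimum r_S on the hull, and rotundity makes
   the minimizer c_S unique. By compactness, points of the hull at which this
   function is close to r_S are close to c_S. If the Hausdorff distance from S
   to T is e, then c_T is within e of a point of Conv(S), at which the function
   is at most r_T + 2 e <= r_S + 4 e; this gives the continuity of the center,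
   and that of the radius follows from |r_S - r_T| <= 2 e. *)
Require Import Defs.
From HB Require Import structures.
From mathcomp Require Import all_boot all_order all_algebra finmap.
From mathcomp Require Import all_classical all_reals all_analysis.
From mathcomp Require Import ring lra.

Set Implicit Arguments.
Unset Strict Implicit.
Unset Printing Implicit Defensive.

Import Order.TTheory GRing.Theory Num.Theory.
Import numFieldNormedType.Exports.

Local Open Scope classical_set_scope.
Local Open Scope ring_scope.

(** * Compactness of the convex hull of a finite set *)

Section convex_hull.
Context {R : realType} {V : normedModType R}.
Implicit Types (A K : set V) (x y z : V) (t : R).

Lemma convex_setP A : convex_set A <->
  forall x y t, A x -> A y -> 0 <= t -> t <= 1 -> A (t *: x + (1 - t) *: y).
Proof.
split=> [cA x y t Ax Ay t0 t1|cA x y l /set_mem Ax /set_mem Ay].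
  exact: set_mem (cA x y (Itv01 t0 t1) (mem_set Ax) (mem_set Ay)).
by apply/mem_set/cA.
Qed.

Lemma convex_conv_hull A : convex_set (conv_hull A).
Proof.
apply/convex_setP => x y t Ax Ay t0 t1 B [cB AB].
by move/convex_setP : (cB); apply => //; [exact: Ax|exact: Ay].
Qed.

Lemma convex_set1 x : convex_set [set x].
Proof.
by apply/convex_setP => _ _ t -> -> _ _; rewrite -scalerDl addrC subrK scale1r.
Qed.

Definition join x K : set V :=
  (fun p : R * V => (1 - p.1) *: x + p.1 *: p.2) @` (`[0, 1] `*` K).

(** Mixing the points with parameters [t] and [u] in proportion [l] puts total weight [w] on [K];
    dividing by [w] turns the part in [K] into a convex combination of [y] and [z]. *)
Lemma convex_join x K : convex_set K -> convex_set (join x K).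
Proof.
move=> /convex_setP cK; apply/convex_setP => _ _ l
  [[t y] [/= + Ky] <-] [[u z] [/= + Kz] <-] l0 l1.
rewrite !in_itv/= => /andP[t0 t1] /andP[u0 u1].
pose w := l * t + (1 - l) * u.
have lt0 : 0 <= l * t by rewrite mulr_ge0.
have lu0 : 0 <= (1 - l) * u by rewrite mulr_ge0// subr_ge0.
have [w0|w_neq0] := eqVneq w 0.
  have [/eqP lt_eq0 /eqP lu_eq0] : l * t == 0 /\ (1 - l) * u == 0.
    by apply/andP; rewrite -paddr_eq0// -/w w0.
  (* For [w = 0] the mixture is the apex [x], so any point of [K] can accompany the parameter 0. *)
  exists (0, y); first by split => //=; rewrite in_itv/= lexx ler01.
  rewrite /= !scalerDr !scalerA lt_eq0 lu_eq0 !scale0r !addr0 -scalerDl.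
  by congr (_ *: x); rewrite !mulrBr lt_eq0 lu_eq0; ring.
have w_gt0 : 0 < w by rewrite lt_neqAle eq_sym w_neq0 addr_ge0.
exists (w, (l * t / w) *: y + (1 - l * t / w) *: z).
  split => /=.
    rewrite in_itv/= ltW//=; rewrite /w; nra.
  apply: cK => //; first by rewrite divr_ge0// ltW.
  by rewrite ler_pdivrMr// mul1r /w lerDl.
rewrite /= !scalerDr !scalerA addrACA -!scalerDl.
congr (_ *: x + (_ *: y + _ *: z)).
- by rewrite /w; ring.
- by rewrite mulrCA divff// mulr1.
- by rewrite mulrBr mulrCA divff// /w; ring.
Qed.

Lemma compact_join x K : compact K -> compact (join x K).
Proof.
move=> cK; apply: continuous_compact; last first.
  by apply: compact_setX => //; exact: segment_compact.
apply: continuous_subspaceT => p; apply: cvgD.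
  by apply: cvgZ; [apply: cvgB; [exact: cvg_cst|exact: cvg_fst]|exact: cvg_cst].
by apply: cvgZ; [exact: cvg_fst|exact: cvg_snd].
Qed.

(** The join is convex and contains [x] (parameter 0) and [A] (parameter 1). Reaching [x] still
    takes a partner in the hull of [A], whence the nonemptiness. *)
Lemma conv_hull_setU1 x A : A !=set0 ->
  conv_hull (x |` A) = join x (conv_hull A).
Proof.
move=> [a Aa]; apply/seteqP; split.
  apply: smallest_sub; first exact/convex_join/convex_conv_hull.
  move=> y [->|Ay].
    exists (0, a); last by rewrite /= subr0 scale0r scale1r addr0.
    by split => /=; [rewrite in_itv/= lexx ler01|exact: sub_gen_smallest].
  exists (1, y); last by rewrite /= subrr scale0r scale1r add0r.
  by split => /=; [rewrite in_itv/= lexx ler01|exact: sub_gen_smallest].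
move=> _ [[t y] [/= + Ay] <-]; rewrite in_itv/= => /andP[t0 t1].
rewrite addrC.
have /convex_setP cxA := @convex_conv_hull (x |` A); apply: cxA => //.
  apply: smallest_sub Ay; first exact: convex_conv_hull.
  by move=> z Az; apply: sub_gen_smallest; right.
by apply: sub_gen_smallest; left.
Qed.

(** The form [x :: s] keeps the induction away from the empty list, where [conv_hull_setU1] does not
    apply. *)
Lemma compact_conv_hull_seq x (s : seq V) : compact (conv_hull [set` x :: s]).
Proof.
elim: s x => [|y s IH] x.
  rewrite (_ : [set` [:: x]] = [set x]); last first.
    by apply/seteqP; split=> z /=; rewrite inE => /eqP.
  by rewrite /conv_hull smallest_id; [exact: compact_set1|exact: convex_set1].
rewrite (_ : [set` x :: y :: s] = x |` [set` y :: s]); last first.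
  apply/seteqP; split=> z /=; first by rewrite inE => /predU1P.
  by rewrite [z \in _]inE => -[->|zs]; apply/orP; [left|right].
rewrite conv_hull_setU1; first exact: compact_join.
by exists y; rewrite /= mem_head.
Qed.

End convex_hull.

(** * Farthest distances and their variation with the point and the set *)

Section farthest_distance.
Context {R : realType} {V : normedModType R}.
Implicit Types (S T : Exp_M V) (c v w : V) (r e : R).

Definition farthest S v : R := max_over S (fun s => `|s - v|).

Lemma farthest_leP S v r :
  farthest S v <= r <-> forall s, s \in points S -> `|s - v| <= r.
Proof.
split=> [Sr s sS|Sr].
  by apply: le_trans Sr; exact: (max_over_ge (fun s => `|s - v|)).
have [s sS] := max_over_attained S (fun s => `|s - v|).
by rewrite /farthest => ->; exact: Sr.
Qed.

Lemma farthest_ge0 S v : 0 <= farthest S v.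
Proof.
have /farthest_leP := lexx (farthest S v).
by move=> /(_ _ (some_point_in S)); exact: le_trans.
Qed.

Lemma farthest_le_add S v w : farthest S v <= farthest S w + `|w - v|.
Proof.
have /farthest_leP Sw := lexx (farthest S w).
apply/farthest_leP => s sS.
by rewrite (le_trans (ler_distD w s v))// lerD2r Sw.
Qed.

Lemma farthest_hausdorff S T v :
  farthest S v <= farthest T v + hausdorff_dist S T.
Proof.
have /farthest_leP Tv := lexx (farthest T v).
have /hausdorff_dist_leP[ST _] := lexx (hausdorff_dist S T).
apply/farthest_leP => s /ST[t /Tv tv st].
by rewrite (le_trans (ler_distD t s v))// addrC lerD.
Qed.

Lemma continuous_farthest S : continuous (farthest S).
Proof.
move=> v; apply/cvgrPdist_lt => e e0; near=> w.
have vw : `|v - w| < e by near: w; exact: cvgr_dist_lt.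
rewrite (le_lt_trans _ vw)// ler_distl; apply/andP; split.
  by rewrite lerBlDr farthest_le_add.
by rewrite distrC farthest_le_add.
Unshelve. all: by end_near. Qed.

Lemma enclosesP S c r :
  encloses S c r <-> conv_hull [set` points S] c /\ farthest S c <= r.
Proof.
split=> [[_ cS Sr]|[cS Sr]].
  by split=> //; apply/farthest_leP => s /Sr; rewrite /closed_ball_/= distrC.
split=> //; first exact: le_trans (farthest_ge0 S c) Sr.
by move=> s sS; rewrite /closed_ball_/= distrC; move/farthest_leP : Sr; exact.
Qed.

Lemma compact_conv_hull S : compact (conv_hull [set` points S]).
Proof.
rewrite (_ : [set` points S] = [set` some_point S :: points S]).
  exact: compact_conv_hull_seq.
apply/seteqP; split=> z /=; first by rewrite inE => ->; rewrite orbT.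
by rewrite inE => /predU1P[->|//]; exact: some_point_in.
Qed.

(** The points within [e] of the hull of [S] form a convex set containing [T]. *)
Lemma conv_hull_hausdorff S T c : conv_hull [set` points T] c ->
  exists2 c', conv_hull [set` points S] c' & `|c - c'| <= hausdorff_dist S T.
Proof.
set e := hausdorff_dist S T.
have /hausdorff_dist_leP[_ TS] := lexx e.
apply: (smallest_sub (X := [set c | exists2 c', _ & `|c - c'| <= e])) c.
  apply/convex_setP => x y t [x' xS xx'] [y' yS yy'] t0 t1.
  exists (t *: x' + (1 - t) *: y').
    have /convex_setP cS := @convex_conv_hull _ _ [set` points S].
    exact: cS.
  rewrite opprD addrACA -!scalerBr (le_trans (ler_normD _ _))// !normrZ.
  by rewrite !ger0_norm ?subr_ge0//; nra.
move=> t /TS[s sS st]; exists s; first exact: sub_gen_smallest.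
by rewrite distrC.
Qed.

(** * Existence and uniqueness of the minimal ball *)

Lemma rme_radius_le S v :
  conv_hull [set` points S] v -> rme_radius S <= farthest S v.
Proof.
move=> vS; apply: ge_inf; last by exists v.
by exists 0 => _ [w _ <-]; exact: farthest_ge0.
Qed.

Lemma rme_radius_attained S :
  exists2 c, conv_hull [set` points S] c & farthest S c = rme_radius S.
Proof.
have S0 : conv_hull [set` points S] (some_point S).
  by apply: sub_gen_smallest; exact: some_point_in.
have [|||c /set_mem cS minc] :=
    @compact_EVT_min _ _ (farthest S) (conv_hull [set` points S]).
- by exists (some_point S).
- exact: compact_conv_hull.
- exact: continuous_subspaceT (@continuous_farthest S).
exists c => //; apply/eqP; rewrite eq_le rme_radius_le// andbT.
apply: lb_le_inf; first by exists (farthest S (some_point S)), (some_point S).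
by move=> _ [v vS <-]; apply: minc; rewrite inE.
Qed.

Lemma restricted_minimal_enclosingP S c r :
  restricted_minimal_enclosing S c r <->
  [/\ conv_hull [set` points S] c, farthest S c = r & r = rme_radius S].
Proof.
split=> [[/enclosesP[cS Sr] minr]|[cS Sc rS]].
  have [c' c'S Sc'] := rme_radius_attained S.
  have rS : r = rme_radius S.
    apply/eqP; rewrite eq_le (le_trans (rme_radius_le cS))// andbT.
    by apply: (minr c'); apply/enclosesP; rewrite Sc'.
  by split=> //; apply/eqP; rewrite eq_le Sr rS rme_radius_le.
split; first by apply/enclosesP; rewrite Sc.
by move=> c' r' /enclosesP[c'S]; apply: le_trans; rewrite rS rme_radius_le.
Qed.

(** Since the infimum is attained, [xget] never returns its default 0. *)
Lemma rme_centerP S : conv_hull [set` points S] (rme_center S) /\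
  farthest S (rme_center S) = rme_radius S.
Proof.
have [c cS Sc] := rme_radius_attained S.
have [|r /restricted_minimal_enclosingP[? -> ->]//] :=
  @xgetPex _ 0 [set c | exists r, restricted_minimal_enclosing S c r].
by exists c, (rme_radius S); apply/restricted_minimal_enclosingP.
Qed.

(** The factor 2 pays once for moving the center into the hull of [S] and once for replacing [T] by
    [S]. *)
Lemma rme_radius_hausdorff S T :
  rme_radius S <= rme_radius T + 2 * hausdorff_dist S T.
Proof.
have [cT <-] := rme_centerP T.
have [c' c'S cc'] := conv_hull_hausdorff S cT.
rewrite (le_trans (rme_radius_le c'S))//.
have := farthest_le_add S c' (rme_center T).
have := farthest_hausdorff S T (rme_center T).
lra.
Qed.

Lemma rme_radius_lipschitz S T :
  `|rme_radius S - rme_radius T| <= 2 * hausdorff_dist S T.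
Proof.
rewrite ler_distl lerBlDr {1}hausdorff_dist_sym; apply/andP.
by split; exact: rme_radius_hausdorff.
Qed.

(* At a farthest point [s] from the midpoint of two optimal centers [c], [c'],
   the vectors [s - c], [s - c'] and their mean all have the minimal radius as
   norm. *)
Lemma rotund_center_uniq S c c' : rotund V ->
  conv_hull [set` points S] c -> conv_hull [set` points S] c' ->
  farthest S c <= rme_radius S -> farthest S c' <= rme_radius S -> c = c'.
Proof.
move=> hV cS c'S /farthest_leP Sc /farthest_leP Sc'.
pose m := 2^-1 *: (c + c').
have mS : conv_hull [set` points S] m.
  have /convex_setP cvS := @convex_conv_hull _ _ [set` points S].
  rewrite /m scalerDr {2}(_ : 2^-1 = 1 - 2^-1 :> R); last by lra.
  by apply: cvS => //; lra.
have [s sS Sm] := max_over_attained S (fun s => `|s - m|).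
have := rme_radius_le mS; rewrite /farthest Sm.
have -> : s - m = 2^-1 *: ((s - c) + (s - c')).
  rewrite addrACA -opprD scalerBr; congr (_ - _).
  by rewrite scalerDr -scalerDl (_ : 2^-1 + 2^-1 = 1 :> R) ?scale1r//; lra.
have := Sc s sS; have := Sc' s sS.
have : `|2^-1 *: ((s - c) + (s - c'))| <= 2^-1 * (`|s - c| + `|s - c'|).
  by rewrite normrZ ger0_norm// ler_wpM2l// ler_normD.
move=> mcc' sc' sc rm.
suff : s - c = s - c' by move=> /addrI/oppr_inj.
(* The radius bounds the norm of the mean from below and both other norms from above, so the
   triangle inequality is an equality throughout. *)
apply: hV; lra.
Qed.

(** Off the ball of radius [e] about the center, the hull is compact; the minimum of [farthest S]
    there exceeds the radius by uniqueness, and the excess serves as [d]. *)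
Lemma rotund_near_center S e : rotund V -> 0 < e ->
  exists2 d, 0 < d & forall v, conv_hull [set` points S] v ->
    farthest S v < rme_radius S + d -> `|rme_center S - v| < e.
Proof.
move=> hV e0; have [cS Sc] := rme_centerP S.
pose K := conv_hull [set` points S] `&` ~` ball (rme_center S) e.
(* If the hull lies inside the ball there is no minimum to take, and any positive [d] works. *)
have [K0|/set0P K0] := eqVneq K set0.
  exists 1 => // v vS _; apply: contrapT => ve.
  have : K v by split=> //; rewrite -ball_normE.
  by rewrite K0.
have [||v0 /set_mem[v0S v0e] minv0] :=
    @compact_EVT_min _ _ (farthest S) K K0.
- apply: compact_closedI; first exact: compact_conv_hull.
  exact/open_closedC/ball_open.
- exact: continuous_subspaceT (@continuous_farthest S).
exists (farthest S v0 - rme_radius S).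
  rewrite subr_gt0 ltNge; apply/negP => Sv0; apply: v0e.
  rewrite (@rotund_center_uniq S v0 (rme_center S)) ?Sc//.
  exact: ballxx.
move=> v vS; rewrite addrC subrK ltNge => /negP Sv; apply: contrapT => ve.
by apply: Sv; apply: minv0; rewrite inE; split=> //; rewrite -ball_normE.
Qed.

(** * Continuity of the radius and of the center *)

Lemma near_hausdorff S e : 0 < e -> \forall T \near S, hausdorff_dist S T < e.
Proof. by move=> e0; exact: (nbhsx_ballx S e e0). Qed.

Lemma rme_radius_continuous : continuous (@rme_radius R V).
Proof.
move=> S; apply/(@cvgrPdist_lt _ _ _ (nbhs S)) => e e0; near=> T.
rewrite (le_lt_trans (rme_radius_lipschitz S T))// mulrC -ltr_pdivlMr//.
by near: T; apply: near_hausdorff; rewrite divr_gt0.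
Unshelve. all: by end_near. Qed.

Lemma rme_center_continuous : rotund V -> continuous (@rme_center R V).
Proof.
move=> hV S; apply/(@cvgrPdist_lt _ _ _ (nbhs S)) => e e0.
have [|d d0 near_c] := @rotund_near_center S (e / 2) hV.
  by rewrite divr_gt0.
near=> T.
have STe : hausdorff_dist S T < e / 2.
  by near: T; apply: near_hausdorff; rewrite divr_gt0.
(* Four Hausdorff distances separate [farthest S c'] from [rme_radius S]: one for moving the center
   to [c'], one for replacing [S] by [T], two for comparing the radii. *)
have STd : hausdorff_dist S T < d / 4.
  by near: T; apply: near_hausdorff; rewrite divr_gt0.
have [cT Tc] := rme_centerP T.
have [c' c'S cc'] := conv_hull_hausdorff S cT.
have := near_c _ c'S.
have := farthest_le_add S c' (rme_center T).
have := farthest_hausdorff S T (rme_center T).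
have := rme_radius_hausdorff T S; rewrite hausdorff_dist_sym.
have := ler_distD c' (rme_center S) (rme_center T); rewrite (distrC c').
move=> h1 h2 h3 h4 h5.
have {}h5 : `|rme_center S - c'| < e / 2 by apply: h5; lra.
lra.
Unshelve. all: by end_near. Qed.

End farthest_distance.

Theorem theorem3p7 (R : realType) (V : normedModType R) (hV : rotund V) :
  [/\ forall S : Exp_M V,
        exists! cr : V * R, restricted_minimal_enclosing S cr.1 cr.2,
      forall (S : Exp_M V) (c : V) (r : R),
        restricted_minimal_enclosing S c r -> r = rme_radius S
    & continuous ((fun S => (rme_center S, rme_radius_nonneg S))
        : Exp_M V -> V * nonneg_reals R)].
Proof.
split.
- move=> S; have [cS Sc] := rme_centerP S.
  exists (rme_center S, rme_radius S); split.
    exact/restricted_minimal_enclosingP.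
  move=> [c' r'] /= /restricted_minimal_enclosingP[c'S Sc' r'S].
  congr (_, _); last by rewrite r'S.
  by apply: (rotund_center_uniq hV cS c'S); rewrite ?Sc ?Sc' ?r'S.
- by move=> S c r /restricted_minimal_enclosingP[].
- have rad_cont : continuous (@rme_radius_nonneg R V).
    (* The topology of [nonneg_reals] is initial for the inclusion into [R]. *)
    by apply: continuous_comp_initial; exact: rme_radius_continuous.
  (* A neighborhood in the product contains a rectangle [A] times [B], so the two coordinates are
     handled separately. *)
  move=> S U [[A B] [/= cA rB] ABU].
  have FS : Filter (nbhs S) := nbhs_filter (S : Exp_M V).
  apply: (@filterS2 _ (nbhs S) FS _ _ _ _ (rme_center_continuous hV cA)
    (rad_cont S B rB)).
  by move=> T TA TB; exact: ABU.
Qed.
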